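(* Let $\Gamma$ be a finite simple unweighted digraph of order $n$ with Laplacian matrix $L$, and let $Q$ be a restrictor matrix of order $n$. Then $L$ is normal if and only if $Q^*LQ$ is normal and $\Gamma$ is balanced.
   Context: The Laplacian of a digraph is $L=D-A$, with $A$ the adjacency matrix (no loops) and $D$ the diagonal matrix of out-degrees. $\mathbf{e}$ is the all-ones vector of length $n$. A restrictor matrix of order $n$ is an $n\times(n-1)$ matrix with orthonormal columns, each orthogonal to $\mathbf{e}$. $\Gamma$ is balanced if every vertex has in-degree equal to out-degree. A complex matrix $M$ is normal if $MM^*=M^*M$. *)

(* Defs.v *)
From HB Require Import structures.
From mathcomp Require Import all_boot all_order all_algebra.

Set Implicit Arguments.
Unset Strict Implicit.
Unset Printing Implicit Defensive.

Import GRing.Theory Num.Theory.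

Local Open Scope ring_scope.
Local Open Scope sesquilinear_scope.

(* No loops and no parallel arcs; opposite arcs i -> j, j -> i may coexist. *)
Record digraph (n : nat) := Digraph {
  arc :> rel 'I_n;
  arc_irr : irreflexive arc
}.

Section Digraph.

Context {n : nat} (G : digraph n).

Definition outdeg (i : 'I_n) : nat := #|[set j | G i j]|.
Definition indeg (i : 'I_n) : nat := #|[set j | G j i]|.

Definition balanced : Prop := forall i : 'I_n, indeg i = outdeg i.

Definition adjmx (C : numClosedFieldType) : 'M[C]_n :=
  \matrix_(i, j) (G i j)%:R.

Definition outdegmx (C : numClosedFieldType) : 'M[C]_n :=
  diag_mx (\row_i (outdeg i)%:R).

Definition laplacian (C : numClosedFieldType) : 'M[C]_n :=
  outdegmx C - adjmx C.

End Digraph.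

(* [dotmx] is the standard Hermitian product on row vectors, hence the
   transposes; [const_mx 1] is the all-ones vector. *)
Definition restrictor {C : numClosedFieldType} {n : nat}
    (Q : 'M[C]_(n, n.-1)) : Prop :=
  (forall i j : 'I_n.-1, dotmx (col i Q)^T (col j Q)^T = (i == j)%:R) /\
  (forall i : 'I_n.-1, dotmx (col i Q)^T (const_mx 1) = 0).

(* Main.v *)
(* Let e be the all-ones column. Always L e = 0, and G is balanced iff
   e^* L = 0. If L is normal then |e^* L|^2 = e^* L L^* e = e^* L^* L e = 0, so
   G is balanced. Conversely Q Q^* is the orthogonal projector onto the
   complement of e, so for balanced G it fixes L and L^* on both sides; hence
   compression by Q is multiplicative and loses no information on L L^* and
   L^* L. *)
Require Import Defs.
From HB Require Import structures.
From mathcomp Require Import all_boot all_order all_algebra.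

Set Implicit Arguments.
Unset Strict Implicit.
Unset Printing Implicit Defensive.

Import GRing.Theory Num.Theory.

Local Open Scope ring_scope.
Local Open Scope sesquilinear_scope.

Section ConjugateTranspose.

Variable C : numClosedFieldType.

Lemma trmxC_mul m n p (A : 'M[C]_(m, n)) (B : 'M[C]_(n, p)) :
  (A *m B)^t* = B^t* *m A^t*.
Proof. by rewrite trmx_mul map_mxM. Qed.

Lemma trmxC0 m n : (0 : 'M[C]_(m, n))^t* = 0.
Proof. by rewrite trmx0 map_mx0. Qed.

Lemma trmxC_const1 m n : (const_mx 1 : 'M[C]_(m, n))^t* = const_mx 1.
Proof. by rewrite trmx_const map_const_mx rmorph1. Qed.

Lemma mulmxC_row_eq0 n (v : 'rV[C]_n) : v *m v^t* = 0 -> v = 0.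
Proof.
move=> v0; apply/eqP; apply: contraT => /dotmx_is_dotmx.
by rewrite dotmxE v0 mxE Order.POrderTheory.ltxx.
Qed.

(** For the row [v = x^* A], normality gives [v v^* = x^* A A^* x = x^* A^* A x = 0], and the
    Hermitian product is definite. *)
Lemma normalmx_cokernel n (A : 'M[C]_n) (x : 'cV[C]_n) :
  A \is normalmx -> A *m x = 0 -> x^t* *m A = 0.
Proof.
move=> /normalmxP nA Ax0; apply: mulmxC_row_eq0.
by rewrite trmxC_mul trmxCK mulmxA -(mulmxA _ A) nA -!mulmxA Ax0 !mulmx0.
Qed.

End ConjugateTranspose.

Section Restrictor.

Variables (C : numClosedFieldType) (n : nat) (Q : 'M[C]_(n, n.-1)).
Hypotheses (n_gt0 : (0 < n)%N) (hQ : restrictor Q).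

Lemma restrictor_isometry : Q^t* *m Q = 1%:M.
Proof.
(* [dotmx] conjugates its second argument, hence the swapped indices. *)
apply/matrixP=> i j; have := hQ.1 j i.
rewrite dotmxE !mxE eq_sym => <-; apply: eq_bigr => k _.
by rewrite !mxE mulrC.
Qed.

Lemma restrictor_ones : Q^t* *m (const_mx 1 : 'cV_n) = 0.
Proof.
apply/matrixP=> i j; have := hQ.2 i.
(* Here the hypothesis conjugates the ones, not the column of [Q], so the entry is the conjugate of
   a sum known to be 0. *)
rewrite dotmxE mxE => d0; rewrite !mxE -[RHS]conjC0 -[in RHS]d0 rmorph_sum.
by apply: eq_bigr => k _; rewrite !mxE rmorphM /= conjCK.
Qed.

(* The square matrix with columns e / n and those of Q has left inverse with
   rows e^* and those of Q^*; as it is square, this is also a right inverse. *)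
Lemma restrictor_projector :
  n%:R^-1 *: (const_mx 1 : 'cV_n) *m (const_mx 1 : 'rV_n) + Q *m Q^t* = 1%:M.
Proof.
(* Writing [n] as [m.+1] turns [n.-1] into [m], so that the block matrices [V] and [W] are
   square. *)
case: n n_gt0 Q hQ restrictor_isometry restrictor_ones => // m _ Q' _ QQ Qe /=.
pose V : 'M[C]_(1 + m, m.+1) := col_mx (const_mx 1) (Q'^t*).
pose W : 'M[C]_(m.+1, 1 + m) := row_mx (m.+1%:R^-1 *: const_mx 1) Q'.
suff /mulmx1C : V *m W = 1%:M by rewrite mul_row_col.
rewrite mul_col_row -!scalemxAr QQ Qe scaler0.
have -> : (const_mx 1 : 'rV_m.+1) *m Q' = 0.
  by rewrite -(trmxCK Q') -trmxC_const1 -trmxC_mul Qe trmxC0.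
suff -> : m.+1%:R^-1 *: ((const_mx 1 : 'rV_m.+1) *m const_mx 1)
    = 1%:M :> 'M[C]_1.
  by rewrite -scalar_mx_block.
apply/matrixP=> i j; rewrite !ord1 !mxE eqxx.
under eq_bigr do rewrite !mxE mulr1.
by rewrite sumr_const card_ord mulVf // pnatr_eq0.
Qed.

(** [Q Q^*] differs from the identity by a multiple of [e e^*], which [A] annihilates. *)
Lemma mulmx_projector_id m (A : 'M[C]_(m, n)) :
  A *m (const_mx 1 : 'cV_n) = 0 -> A *m (Q *m Q^t*) = A.
Proof.
move=> Ae; rewrite -[RHS]mulmx1 -restrictor_projector mulmxDr.
by rewrite -scalemxAl -scalemxAr !mulmxA Ae mul0mx scaler0 add0r.
Qed.

Lemma projector_mulmx_id m (A : 'M[C]_(n, m)) :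
  (const_mx 1 : 'rV_n) *m A = 0 -> Q *m Q^t* *m A = A.
Proof.
move=> eA; rewrite -[RHS]mul1mx -restrictor_projector mulmxDl -[X in X + _]mulmxA.
by rewrite eA mulmx0 add0r.
Qed.

Lemma compression_normal (A : 'M[C]_n) :
  A *m (const_mx 1 : 'cV_n) = 0 -> (const_mx 1 : 'rV_n) *m A = 0 ->
  (Q^t* *m A *m Q \is normalmx) = (A \is normalmx).
Proof.
move=> Ae eA.
have Ase : A^t* *m (const_mx 1 : 'cV_n) = 0.
  by rewrite -trmxC_const1 -trmxC_mul eA trmxC0.
have eAs : (const_mx 1 : 'rV_n) *m A^t* = 0.
  by rewrite -trmxC_const1 -trmxC_mul Ae trmxC0.
(* The inner [Q Q^*] is absorbed by [B], so [D] is arbitrary. *)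
have compM (B D : 'M[C]_n) : B *m (const_mx 1 : 'cV_n) = 0 ->
    Q^t* *m B *m Q *m (Q^t* *m D *m Q) = Q^t* *m (B *m D) *m Q.
  by move=> Be; rewrite -{2}(mulmx_projector_id Be) !mulmxA.
(* Only the outer sides of the product meet [Q Q^*]: [B] absorbs it on the left, [D] on the
   right. *)
have compK (B D : 'M[C]_n) : D *m (const_mx 1 : 'cV_n) = 0 ->
    (const_mx 1 : 'rV_n) *m B = 0 ->
    Q *m (Q^t* *m (B *m D) *m Q) *m Q^t* = B *m D.
  move=> De eB; rewrite -[in RHS](projector_mulmx_id eB).
  by rewrite -[in RHS](mulmx_projector_id De) !mulmxA.
have compC : (Q^t* *m A *m Q)^t* = Q^t* *m A^t* *m Q.
  by rewrite !trmxC_mul trmxCK mulmxA.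
apply/normalmxP/normalmxP; rewrite compC !compM //; last by move->.
by move=> /(congr1 (fun M => Q *m M *m Q^t*)); rewrite !compK.
Qed.

End Restrictor.

Section Laplacian.

Variables (C : numClosedFieldType) (n : nat) (G : digraph n).

Lemma sum_arc_natr (P : pred 'I_n) : \sum_j (P j)%:R = #|[set j | P j]|%:R :> C.
Proof. by rewrite -natr_sum -sum1dep_card [in RHS]big_mkcond. Qed.

Lemma laplacianE i j :
  laplacian G C i j = (outdeg G i)%:R *+ (i == j) - (G i j)%:R.
Proof. by rewrite !mxE. Qed.

Lemma laplacian_ones : laplacian G C *m (const_mx 1 : 'cV_n) = 0.
Proof.
apply/matrixP=> i j; rewrite !mxE.
under eq_bigr do rewrite [const_mx _ _ _]mxE mulr1 laplacianE.
rewrite sumrB sum_arc_natr (bigD1 i) //= eqxx big1 ?addr0 ?subrr //.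
by move=> k; rewrite eq_sym => /negPf ->.
Qed.

(** Column [i] of the Laplacian sums to out-degree minus in-degree, and distinct naturals stay
    distinct in [C]. *)
Lemma balanced_ones_laplacian :
  balanced G <-> (const_mx 1 : 'rV_n) *m laplacian G C = 0.
Proof.
have colsum i : ((const_mx 1 : 'rV_n) *m laplacian G C) 0 i =
    (outdeg G i)%:R - (indeg G i)%:R.
  rewrite mxE; under eq_bigr do rewrite [const_mx _ _ _]mxE mul1r laplacianE.
  rewrite sumrB (sum_arc_natr (G^~ i)) (bigD1 i) //= eqxx big1 ?addr0 //.
  by move=> k /negPf ->.
split=> [bG | L0 i].
  by apply/rowP=> i; rewrite colsum bG subrr mxE.
by apply/eqP; rewrite -(eqr_nat C) eq_sym -subr_eq0 -colsum L0 mxE.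
Qed.

End Laplacian.

Theorem theorem3p3 (C : numClosedFieldType) (n : nat) (hn : (0 < n)%N)
    (G : digraph n) (Q : 'M[C]_(n, n.-1)) (hQ : restrictor Q) :
  laplacian G C \is normalmx <->
  (Q^t* *m laplacian G C *m Q \is normalmx) /\ balanced G.
Proof.
have Le := laplacian_ones C G.
split=> [nL | [nQ /(balanced_ones_laplacian C) eL]]; last first.
  by rewrite -(compression_normal hn hQ).
(* Normality moves the kernel vector [e] to the left side, giving both balance and the condition for
   comparing [L] with its compression. *)
have eL : (const_mx 1 : 'rV_n) *m laplacian G C = 0.
  by rewrite -(trmxC_const1 C n 1) normalmx_cokernel.
by split; [rewrite (compression_normal hn hQ) | apply/balanced_ones_laplacian/eL].
Qed.
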